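(* Let $\mathcal{M}$ be a monoid generated by a finite set $G'$, and suppose the word problem for $\mathcal{M}$ (with respect to $G'$) is decidable. Then $\mathcal{R}((\mathcal{M},G'))\subseteq\mathrm{RE}$, where $\mathrm{RE}$ is the class of recursively enumerable languages.
   Context: For a monoid $\mathcal{M}$ generated by a finite set $G'=\{g_1,\dots,g_n\}$, the monoid memory model $(\mathcal{M},G')$ is the Cayley graph: cells are the elements of $\mathcal{M}$, the initial cell is the identity, and for each $x\in\mathcal{M}$ and each $g_k$ there is an edge $x\to xg_k$ marked $g_k$. An $h$-head automaton with auxiliary memory of model $M$ has a finite state set, input alphabet with endmarkers, a finite memory alphabet $\Delta$, a transition function mapping (state, the $h$ symbols under its 2-way read-only input heads, the current memory symbol) to (new state, a move in $\{-1,0,+1\}$ per head, and a mark to follow from the current cell or ''stay''), an initial state and accepting states; it starts with heads at the leftmost input symbol and memory at the initial cell and runs deterministically for a fixed memory content $\mu\colon M\to\Delta$. It accepts $w$ iff for some $\mu$ it reaches an accepting state; $\mathcal{R}(M)$ is the class of languages so recognized. *)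

(* Defs.v *)
From HB Require Import structures.
From mathcomp Require Import all_boot.
From mathcomp Require Import finmap.

Set Implicit Arguments.
Unset Strict Implicit.
Unset Printing Implicit Defensive.

(* Kleene's partial recursive functions of arity n. *)
Inductive recf : nat -> Type :=
| RZero n : recf n
| RSucc : recf 1
| RProj n (i : 'I_n) : recf n
| RComp k n (f : recf k) (g : 'I_k -> recf n) : recf n
| RPrim n (f : recf n) (g : recf n.+2) : recf n.+1
| RMin n (f : recf n.+1) : recf n.

(* [reval f v y]: f is defined at v with value y.
   RPrim recurses on the first argument: s is the sequence of its values, and
   g receives (counter, previous value, parameters).
   RMin searches for the least zero in the first argument, f being required to
   be defined at all smaller values. *)
Fixpoint reval n (f : recf n) : n.-tuple nat -> nat -> Prop :=
  match f with
  | RZero _ => fun _ y => y = 0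
  | RSucc => fun v y => y = (thead v).+1
  | RProj _ i => fun v y => y = tnth v i
  | RComp k _ f g => fun v y =>
      exists2 u : k.-tuple nat,
        forall i, reval (g i) v (tnth u i) & reval f u y
  | RPrim n f g => fun v y =>
      exists s : nat -> nat,
        [/\ reval f [tuple of behead v] (s 0),
            forall i, i < thead v ->
              reval g [tuple of i :: s i :: behead v] (s i.+1)
          & y = s (thead v)]
  | RMin _ f => fun v y =>
      reval f [tuple of y :: v] 0 /\
      forall i, i < y -> exists z, reval f [tuple of i :: v] z.+1
  end.

(* Effective coding of words: letters are numbered by [enum_rank], and
   [CodeSeq.code] is the library's bijection between seq nat and nat. *)
Definition word_code (S : finType) (w : seq S) : nat :=
  CodeSeq.code [seq val (enum_rank a) | a <- w].

Definition language (S : finType) := seq S -> Prop.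

Definition RE (S : finType) (L : language S) : Prop :=
  exists f : recf 1,
    forall w, L w <-> exists y, reval f [tuple word_code w] y.

(* The characteristic function of the relation P on words is recursive. *)
Definition recursive_word_rel (S : finType) (P : seq S -> seq S -> Prop) : Prop :=
  exists f : recf 2, forall u v,
    (P u v -> reval f [tuple word_code u; word_code v] 1) /\
    (~ P u v -> reval f [tuple word_code u; word_code v] 0).

(* A marked graph in which each cell has exactly one outgoing edge per mark. *)
Record memory_model := MemoryModel {
  cell : Type;
  mark : finType;
  init_cell : cell;
  follow : cell -> mark -> cell
}.

Section Monoid.
Variables (M : monoidType) (G : {fset M}).

Definition word_value (w : seq G) : M := (\prod_(g <- w) val g)%g.

Definition generates : Prop := forall x : M, exists w : seq G, word_value w = x.

Definition decidable_word_problem : Prop :=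
  recursive_word_rel (fun u v : seq G => word_value u = word_value v).

Definition monoid_memory : memory_model :=
  @MemoryModel M G 1%g (fun x g => x * val g)%g.

End Monoid.

Inductive tape_symbol (S : Type) := Letter of S | LeftEnd | RightEnd.
Arguments LeftEnd {S}.
Arguments RightEnd {S}.

Inductive head_move := MoveLeft | MoveStay | MoveRight.

(* The last component of a transition is the mark to follow, None for "stay". *)
Record automaton (M : memory_model) (S : finType) (h : nat) := Automaton {
  state : finType;
  msym : finType;
  trans : state -> {ffun 'I_h -> tape_symbol S} -> msym ->
          state * {ffun 'I_h -> head_move} * option (mark M);
  start : state;
  accepting : {set state}
}.

Section Run.
Variables (M : memory_model) (S : finType) (h : nat) (A : automaton M S h).
Variables (w : seq S) (mu : cell M -> msym A).

(* The endmarkers occupy positions 0 and (size w).+1, w the ones in between. *)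
Definition read (p : nat) : tape_symbol S :=
  if p is i.+1 then
    if onth w i is Some a then Letter a else RightEnd
  else LeftEnd.

(* A head that attempts to cross an endmarker stays on it. *)
Definition move_head (d : head_move) (p : nat) : nat :=
  match d with
  | MoveLeft => p.-1
  | MoveStay => p
  | MoveRight => minn p.+1 (size w).+1
  end.

Record config := Config {
  cstate : state A;
  cheads : {ffun 'I_h -> nat};
  ccell : cell M
}.

Definition init_config : config :=
  Config (start A) [ffun=> 1] (init_cell M).

Definition step (c : config) : config :=
  let: (q, d, m) :=
    trans (cstate c) [ffun i => read (cheads c i)] (mu (ccell c)) in
  Config q [ffun i => move_head (d i) (cheads c i)]
    (if m is Some g then follow (ccell c) g else ccell c).

Definition reaches_accepting : Prop :=
  exists t, cstate (iter t step init_config) \in accepting A.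

End Run.

Definition accepts (M : memory_model) (S : finType) (h : nat)
    (A : automaton M S h) (w : seq S) : Prop :=
  exists mu : cell M -> msym A, reaches_accepting w mu.

Definition recognizable (M : memory_model) (S : finType) (L : language S) : Prop :=
  exists h (A : automaton M S h),
    0 < h /\ forall w, L w <-> accepts A w.

(* Main.v *)
From HB Require Import structures.
(* [finmap] shadows the [pickle] of [all_boot], so it has to come first. *)
From mathcomp Require Import finmap.
From mathcomp Require Import all_boot.
Require Import Defs.

(* Replaying a run only takes the list of the memory symbols that it reads. Such a list
   comes from a memory content iff the same symbol is read at any two times at which the
   words of marks followed so far have the same value in the monoid, the content of the
   cells that are never visited being irrelevant. An oracle for the word problem decides
   this, so that an unbounded search over all lists semidecides acceptance. *)

Set Implicit Arguments.
Unset Strict Implicit.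
Unset Printing Implicit Defensive.

Import CodeSeq.

Lemma reval_functional n (f : recf n) v y z : reval f v y -> reval f v z -> y = z.
Proof.
elim: f v y z => {n} [n||n i|k n f IHf g IHg|n f IHf g IHg|n f IHf] v y z /=.
- by move=> -> ->.
- by move=> -> ->.
- by move=> -> ->.
- case=> u gu fu [u' gu' fu'].
  have eq_u : u = u' by apply: eq_from_tnth => i; apply: IHg (gu i) (gu' i).
  by apply: IHf fu _; rewrite eq_u.
- case=> s [s0 sS ->] [s' [s0' sS' ->]].
  suff eq_s i : i <= thead v -> s i = s' i by exact: eq_s.
  elim: i => [_|i IHi lt_i]; first exact: IHf s0 s0'.
  by apply: IHg (sS _ lt_i) _; rewrite IHi 1?ltnW //; apply: sS'.
- case=> fy fy_lt [fz fz_lt]; case: (ltngtP y z) => // lt_yz.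
  + by have [x fx] := fz_lt _ lt_yz; have := IHf _ _ _ fy fx.
  + by have [x fx] := fy_lt _ lt_yz; have := IHf _ _ _ fz fx.
Qed.

Lemma reval_RMin n (f : recf n.+1) (v : n.-tuple nat) (B : pred nat) :
    (forall i, reval f [tuple of i :: v] (~~ B i)) ->
  forall y, reval (RMin f) v y <-> B y /\ (forall i, i < y -> ~~ B i).
Proof.
move=> fB y; split=> [] /= [fy fy_lt]; split=> [|i lt_iy].
- by have := reval_functional fy (fB y); case: (B y).
- have [x fx] := fy_lt i lt_iy.
  by have := reval_functional fx (fB i); case: (B i).
- by have := fB y; rewrite fy.
- by exists 0; have := fB i; rewrite (fy_lt i lt_iy).
Qed.

(** * Recursive functions of the entries of an environment *)

(* [P] is a type of parameters of which a machine only sees the numbers [env p];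
   the values [F p], coded by [pickle], are then computed uniformly in [p]. Note that
   [pickle] is convertible to the identity on [nat] and to [nat_of_bool] on [bool]. *)
Definition recursive_from (P : Type) n (env : P -> n.-tuple nat) (T : countType)
    (F : P -> T) :=
  exists f : recf n, forall p, reval f (env p) (pickle (F p)).

Section Substitution.
Variables (P : Type) (n : nat) (env : P -> n.-tuple nat).
Implicit Types T U : countType.

Lemma recursive_pickle T U (F : P -> T) (G : P -> U) :
    (forall p, pickle (F p) = pickle (G p)) ->
  recursive_from env F -> recursive_from env G.
Proof. by move=> eqFG [f fP]; exists f => p; rewrite -eqFG. Qed.

Lemma eq_recursive T (F G : P -> T) :
  F =1 G -> recursive_from env F -> recursive_from env G.
Proof. by move=> eqFG; apply: recursive_pickle => p; rewrite eqFG. Qed.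

Lemma recursive_entry T (F : P -> T) k :
  k < n -> (forall p, nth 0 (env p) k = pickle (F p)) -> recursive_from env F.
Proof.
move=> lt_kn env_k; exists (RProj (Ordinal lt_kn)) => p /=.
by rewrite (tnth_nth 0) -env_k.
Qed.

Lemma recursive_reindex (Q : Type) (h : Q -> P) T (F : P -> T) :
  recursive_from env F -> recursive_from (env \o h) (F \o h).
Proof. by case=> f fP; exists f => q; apply: fP. Qed.

Lemma recursive_subst k (env' : P -> k.-tuple nat) T (F : P -> T) :
    (forall i, recursive_from env (fun p => tnth (env' p) i)) ->
  recursive_from env' F -> recursive_from env F.
Proof.
move=> /fin_all_exists [g gP] [f fP]; exists (RComp f g) => p /=.
by exists (env' p) => // i; apply: gP.
Qed.

Lemma recursive_subst1 T U (a : P -> T) (F : P -> U) :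
    recursive_from (fun p => [tuple pickle (a p)]) F -> recursive_from env a ->
  recursive_from env F.
Proof. by move=> recF rec_a; apply: recursive_subst recF => i; rewrite (ord1 i). Qed.

Lemma recursive_subst2 T T' U (a : P -> T) (b : P -> T') (F : P -> U) :
    recursive_from (fun p => [tuple pickle (a p); pickle (b p)]) F ->
    recursive_from env a -> recursive_from env b ->
  recursive_from env F.
Proof.
move=> recF rec_a rec_b; apply: recursive_subst recF => i.
by case: (unliftP ord0 i) => [j ->|->] //; rewrite (ord1 j).
Qed.

Lemma recursive_cut T U (a : P -> T) (F : P -> U) :
    recursive_from (fun p => [tuple of pickle (a p) :: env p]) F ->
  recursive_from env a -> recursive_from env F.
Proof.
move=> recF rec_a; apply: recursive_subst recF => i.
case: (unliftP ord0 i) => [j ->|->] //.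
by exists (RProj j) => p /=; rewrite tnthS.
Qed.

(* [RPrim] runs its step only below the recursion argument, so [R p i.+1] may rely on
   [i < N p]. *)
Lemma recursive_rec_lt T (R : P -> nat -> T) (N : P -> nat) :
    recursive_from env (R^~ 0) ->
    recursive_from
      (fun x : {x : P * nat | x.2 < N x.1} =>
        [tuple of (sval x).2 :: pickle (R (sval x).1 (sval x).2) :: env (sval x).1])
      (fun x => R (sval x).1 (sval x).2.+1) ->
  recursive_from env N -> recursive_from env (fun p => R p (N p)).
Proof.
case=> f fP [g gP]; apply: recursive_cut.
exists (RPrim f g) => p /=; exists (pickle \o R p).
have behead_env : [tuple of behead [tuple of N p :: env p]] = env p by apply: val_inj.
split=> // [|i lt_iN]; first by rewrite behead_env.
set v := (X in reval g X _).
suff -> : v = [tuple of i :: pickle (R p i) :: env p].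
  exact: gP (exist _ (p, i) lt_iN).
exact: val_inj.
Qed.

Lemma recursive_rec T (R : P -> nat -> T) (N : P -> nat) :
    recursive_from env (R^~ 0) ->
    recursive_from (fun x : P * nat => [tuple of x.2 :: pickle (R x.1 x.2) :: env x.1])
      (fun x => R x.1 x.2.+1) ->
  recursive_from env N -> recursive_from env (fun p => R p (N p)).
Proof.
move=> rec0 [g gP]; apply: recursive_rec_lt => //.
by exists g => -[[p i] lt_iN]; apply: gP (p, i).
Qed.

End Substitution.

Lemma recursive_lift (P Q : Type) n (env : P -> n.-tuple nat) (h : Q -> P) a
    (T : countType) (F : P -> T) :
    recursive_from env F ->
  recursive_from (fun q => [tuple of a q :: env (h q)]) (fun q => F (h q)).
Proof.
move=> /(recursive_reindex h) recF; apply: recursive_subst recF => i /=.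
by exists (RProj (lift ord0 i)) => q /=; rewrite tnthS.
Qed.

Lemma recursive_lift2 (P Q : Type) n (env : P -> n.-tuple nat) (h : Q -> P) a b
    (T : countType) (F : P -> T) :
    recursive_from env F ->
  recursive_from (fun q => [tuple of a q :: b q :: env (h q)]) (fun q => F (h q)).
Proof. by move=> recF; apply: (recursive_lift id a (recursive_lift h b recF)). Qed.

(** * Arithmetic *)

Lemma recursive_succ P n (env : P -> n.-tuple nat) (F : P -> nat) :
  recursive_from env F -> recursive_from env (fun p => (F p).+1).
Proof. by move=> recF; apply: recursive_subst1 _ recF; exists RSucc. Qed.

Lemma recursive_const P n (env : P -> n.-tuple nat) (T : countType) (c : T) :
  recursive_from env (fun=> c).
Proof.
apply: (recursive_pickle (F := fun=> pickle c)) => //.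
by elim: (pickle c) => [|k IHk]; [exists (RZero n) | apply: recursive_succ].
Qed.

Lemma recursive_add P n (env : P -> n.-tuple nat) (F G : P -> nat) :
    recursive_from env F -> recursive_from env G ->
  recursive_from env (fun p => F p + G p).
Proof.
move=> recF recG; apply: (recursive_rec (R := fun p i => F p + i)) recG.
  by apply: eq_recursive recF => p; rewrite addn0.
apply: eq_recursive (fun x => esym (addnS _ _)) _.
by apply: recursive_succ; apply: (recursive_entry (k := 1)).
Qed.

Lemma recursive_pred P n (env : P -> n.-tuple nat) (F : P -> nat) :
  recursive_from env F -> recursive_from env (fun p => (F p).-1).
Proof.
apply: (recursive_rec (R := fun _ i => i.-1)); first exact: recursive_const.
exact: (recursive_entry (k := 0)).
Qed.

Lemma recursive_sub P n (env : P -> n.-tuple nat) (F G : P -> nat) :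
    recursive_from env F -> recursive_from env G ->
  recursive_from env (fun p => F p - G p).
Proof.
move=> recF recG; apply: (recursive_rec (R := fun p i => F p - i)) recG.
  by apply: eq_recursive recF => p; rewrite subn0.
apply: eq_recursive (fun x => esym (subnS _ _)) _.
by apply: recursive_pred; apply: (recursive_entry (k := 1)).
Qed.

Lemma recursive_mul P n (env : P -> n.-tuple nat) (F G : P -> nat) :
    recursive_from env F -> recursive_from env G ->
  recursive_from env (fun p => F p * G p).
Proof.
move=> recF recG; apply: (recursive_rec (R := fun p i => F p * i)) recG.
  by apply: eq_recursive (recursive_const _ 0) => p; rewrite muln0.
apply: eq_recursive (fun x => esym (mulnS _ _)) _; apply: recursive_add.
  exact: recursive_lift2 recF.
exact: (recursive_entry (k := 1)).
Qed.

Lemma recursive_exp P n (env : P -> n.-tuple nat) k (F : P -> nat) :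
  recursive_from env F -> recursive_from env (fun p => k ^ F p).
Proof.
apply: (recursive_rec (R := fun _ i => k ^ i)); first exact: recursive_const.
apply: eq_recursive (fun x => esym (expnS _ _)) _; apply: recursive_mul.
  exact: recursive_const.
exact: (recursive_entry (k := 1)).
Qed.

Lemma recursive_negb P n (env : P -> n.-tuple nat) (B : P -> bool) :
  recursive_from env B -> recursive_from env (fun p => ~~ B p).
Proof.
move=> recB; apply: (recursive_pickle (F := fun p => 1 - pickle (B p))) => [p|].
  by case: (B p).
exact: recursive_sub (recursive_const _ 1) recB.
Qed.

Lemma recursive_andb P n (env : P -> n.-tuple nat) (B C : P -> bool) :
    recursive_from env B -> recursive_from env C ->
  recursive_from env (fun p => B p && C p).
Proof.
move=> recB recC.
apply: (recursive_pickle (F := fun p => pickle (B p) * pickle (C p))) => [p|].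
  by case: (B p); case: (C p).
exact: recursive_mul.
Qed.

Lemma recursive_orb P n (env : P -> n.-tuple nat) (B C : P -> bool) :
    recursive_from env B -> recursive_from env C ->
  recursive_from env (fun p => B p || C p).
Proof.
move=> recB recC; apply: (eq_recursive (F := fun p => ~~ (~~ B p && ~~ C p))) => [p|].
  by rewrite negb_and !negbK.
by apply: recursive_negb; apply: recursive_andb; apply: recursive_negb.
Qed.

Lemma recursive_leq P n (env : P -> n.-tuple nat) (F G : P -> nat) :
    recursive_from env F -> recursive_from env G ->
  recursive_from env (fun p => F p <= G p).
Proof.
move=> recF recG.
apply: (recursive_pickle (F := fun p => 1 - (F p - G p))) => [p|].
  by rewrite /leq; case: (F p - G p).
by apply: recursive_sub; [apply: recursive_const | apply: recursive_sub].
Qed.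

Lemma recursive_eq P n (env : P -> n.-tuple nat) (T : countType) (F G : P -> T) :
    recursive_from env F -> recursive_from env G ->
  recursive_from env (fun p => F p == G p).
Proof.
move=> recF recG; pose F' p := pickle (F p); pose G' p := pickle (G p).
apply: (eq_recursive (F := fun p => (F' p <= G' p) && (G' p <= F' p))) => [p|].
  by rewrite -eqn_leq (inj_eq (pcan_inj pickleK)).
by apply: recursive_andb; apply: recursive_leq.
Qed.

Lemma recursive_if P n (env : P -> n.-tuple nat) (T : countType)
    (B : P -> bool) (F G : P -> T) :
    recursive_from env B -> recursive_from env F -> recursive_from env G ->
  recursive_from env (fun p => if B p then F p else G p).
Proof.
move=> recB recF recG.
apply: (recursive_pickle (F := fun p =>
    pickle (B p) * pickle (F p) + pickle (~~ B p) * pickle (G p))) => [p|].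
  by case: (B p); rewrite !(mul1n, mul0n) ?addn0.
by apply: recursive_add; apply: recursive_mul => //; apply: recursive_negb.
Qed.

Lemma recursive_odd P n (env : P -> n.-tuple nat) (F : P -> nat) :
  recursive_from env F -> recursive_from env (fun p => odd (F p)).
Proof.
apply: (recursive_rec (R := fun _ i => odd i)); first exact: recursive_const.
by apply: recursive_negb; apply: (recursive_entry (k := 1)).
Qed.

Lemma recursive_least P n (env : P -> n.-tuple nat) (B : P -> pred nat) (F : P -> nat) :
    (forall p i, i <= F p -> B p i = (i == F p)) ->
    recursive_from (fun x : P * nat => [tuple of x.2 :: env x.1]) (fun x => B x.1 x.2) ->
  recursive_from env F.
Proof.
move=> leastF /recursive_negb [f fP]; exists (RMin f) => p.
apply/(reval_RMin (B := B p)) => [i|]; first exact: fP (p, i).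
split=> [|i lt_iF]; first by rewrite leastF ?eqxx.
by rewrite leastF 1?ltnW // ltn_eqF.
Qed.

Lemma recursive_divn P n (env : P -> n.-tuple nat) (F G : P -> nat) :
    recursive_from env F -> recursive_from env G ->
  recursive_from env (fun p => F p %/ G p).
Proof.
move=> recF recG.
apply: (recursive_least (B := fun p i => (G p == 0) || (F p < i.+1 * G p))) => [p i|].
  case: (posnP (G p)) => [->|G_gt0]; first by rewrite divn0 leqn0.
  by move=> le_i; rewrite -ltn_divLR // ltnS eqn_leq le_i.
have recG' := recursive_lift fst snd recG.
apply: recursive_orb; first exact: recursive_eq recG' (recursive_const _ 0).
apply: recursive_leq; first exact: recursive_succ (recursive_lift fst snd recF).
apply: recursive_mul => //; apply: recursive_succ.
exact: (recursive_entry (k := 0)).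
Qed.

(** * Sequences and pairs *)

Lemma pickle_seq (T : countType) (s : seq T) : pickle s = code (map pickle s).
Proof. by []. Qed.

Lemma code_eq0 s : (code s == 0) = (s == [::]).
Proof. by case: s => //= x s; rewrite muln_eq0 expn_eq0. Qed.

(* [code (x :: s)] is [2 ^ x * (2 * code s + 1)]: [x] halvings lead to an odd number. *)
Lemma odd_divn_code s k :
  k <= head 0 s -> (code s == 0) || odd (code s %/ 2 ^ k) = (k == head 0 s).
Proof.
rewrite code_eq0; case: s => [|x s] /= le_kx; first by rewrite leqn0 in le_kx.
rewrite -{1}(subnK le_kx) expnD mulnAC mulnK ?expn_gt0 // oddM oddX /= odd_double.
by rewrite orbF andbT subn_eq0 eqn_leq le_kx.
Qed.

Lemma code_behead s : code (behead s) = code s %/ 2 ^ (head 0 s).+1.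
Proof.
case: s => [|x s] /=; first by rewrite div0n.
by rewrite expnSr divnMl ?expn_gt0 // divn2 (half_bit_double _ true).
Qed.

Lemma recursive_pickle_head P n (env : P -> n.-tuple nat) (T : countType)
    (s : P -> seq T) :
  recursive_from env s -> recursive_from env (fun p => head 0 (map pickle (s p))).
Proof.
move=> rec_s; pose c p := pickle (s p).
apply: (recursive_least (B := fun p k => (c p == 0) || odd (c p %/ 2 ^ k))) => [p k|].
  exact: odd_divn_code.
have rec_c : recursive_from (fun x => [tuple of x.2 :: env x.1]) (c \o fst).
  exact: (recursive_lift fst snd (F := c) rec_s).
apply: recursive_orb; first exact: recursive_eq rec_c (recursive_const _ 0).
apply: recursive_odd; apply: recursive_divn => //; apply: recursive_exp.
exact: (recursive_entry (k := 0)).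
Qed.

Lemma recursive_behead P n (env : P -> n.-tuple nat) (T : countType) (s : P -> seq T) :
  recursive_from env s -> recursive_from env (fun p => behead (s p)).
Proof.
move=> rec_s; pose c p := pickle (s p).
apply: (recursive_pickle (F :=
    fun p => c p %/ 2 ^ (head 0 (map pickle (s p))).+1)) => [p|].
  by rewrite /c /= -code_behead behead_map.
apply: recursive_divn => //; apply: recursive_exp; apply: recursive_succ.
exact: recursive_pickle_head.
Qed.

Lemma recursive_cons P n (env : P -> n.-tuple nat) (T : countType) (t : P -> T)
    (s : P -> seq T) :
    recursive_from env t -> recursive_from env s ->
  recursive_from env (fun p => t p :: s p).
Proof.
move=> rec_t rec_s; pose c p := pickle (s p).
apply: (recursive_pickle (F :=
    fun p => 2 ^ pickle (t p) * (c p + c p).+1)) => [p|]; first by rewrite addnn.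
apply: recursive_mul; first exact: recursive_exp.
by apply: recursive_succ; apply: recursive_add.
Qed.

Lemma recursive_drop P n (env : P -> n.-tuple nat) (T : countType)
    (k : P -> nat) (s : P -> seq T) :
    recursive_from env k -> recursive_from env s ->
  recursive_from env (fun p => drop (k p) (s p)).
Proof.
move=> rec_k rec_s; apply: (recursive_rec (R := fun p i => drop i (s p))) rec_k.
  by apply: eq_recursive rec_s => p; rewrite drop0.
apply: (eq_recursive (F := fun x => behead (drop x.2 (s x.1)))).
  by case=> p i; rewrite -drop1 drop_drop.
by apply: recursive_behead; apply: (recursive_entry (k := 1)).
Qed.

Lemma recursive_size P n (env : P -> n.-tuple nat) (T : countType) (s : P -> seq T) :
  recursive_from env s -> recursive_from env (fun p => size (s p)).
Proof.
move=> rec_s; apply: (recursive_least (B := fun p i => drop i (s p) == [::])) => [p i|].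
  by move=> le_i; rewrite -size_eq0 size_drop subn_eq0 eqn_leq le_i.
apply: recursive_eq; last exact: recursive_const.
apply: recursive_drop; first exact: (recursive_entry (k := 0)).
exact: (recursive_lift fst snd rec_s).
Qed.

Lemma recursive_ohead P n (env : P -> n.-tuple nat) (T : countType) (t : P -> T)
    (s : P -> seq T) :
    (forall p, ohead (s p) = Some (t p)) ->
  recursive_from env s -> recursive_from env t.
Proof.
move=> head_s /recursive_pickle_head; apply: recursive_pickle => p.
by have := head_s p; case: (s p) => //= x s' [->].
Qed.

Lemma recursive_nth P n (env : P -> n.-tuple nat) (T : countType) (x0 : T)
    (s : P -> seq T) (k : P -> nat) :
    recursive_from env s -> recursive_from env k ->
  recursive_from env (fun p => nth x0 (s p) (k p)).
Proof.
move=> rec_s rec_k; pose r p := drop (k p) (s p).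
have rec_r : recursive_from env r by apply: recursive_drop.
apply: (recursive_pickle (F := fun p =>
    if r p == [::] then pickle x0 else head 0 (map pickle (r p)))) => [p|].
  by rewrite -[k p]addn0 -nth_drop -/(r p); case: (r p).
apply: recursive_if; [|exact: recursive_const|exact: recursive_pickle_head].
by apply: recursive_eq => //; apply: recursive_const.
Qed.

Section Pairs.
Variables (P : Type) (n : nat) (env : P -> n.-tuple nat) (T U : countType).

Lemma recursive_pair (F : P -> T) (G : P -> U) :
    recursive_from env F -> recursive_from env G ->
  recursive_from env (fun p => (F p, G p)).
Proof.
move=> recF recG.
apply: (recursive_pickle (F := fun p => [:: pickle (F p); pickle (G p)])) => //.
do 2! apply: recursive_cons => //; exact: recursive_const.
Qed.

Lemma recursive_fst (F : P -> T * U) :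
  recursive_from env F -> recursive_from env (fun p => (F p).1).
Proof.
move=> recF; apply: (recursive_pickle (F := fun p => pickle (F p).1)) => //.
exact: (recursive_ohead (s := fun p => [:: pickle (F p).1; pickle (F p).2])).
Qed.

Lemma recursive_snd (F : P -> T * U) :
  recursive_from env F -> recursive_from env (fun p => (F p).2).
Proof.
move=> recF; apply: (recursive_pickle (F := fun p => pickle (F p).2)) => //.
apply: (recursive_ohead (s := fun p => [:: pickle (F p).2])) => //.
exact: (recursive_behead (s := fun p => [:: pickle (F p).1; pickle (F p).2])).
Qed.

End Pairs.

(** * Computable functions between countable types *)

Definition computable (X Y : countType) (f : X -> Y) :=
  recursive_from (fun x => [tuple pickle x]) f.

Lemma recursive_comp (P : Type) n (env : P -> n.-tuple nat) (X Y : countType)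
    (f : X -> Y) (F : P -> X) :
    computable f -> recursive_from env F -> recursive_from env (fun p => f (F p)).
Proof. by move=> /(recursive_reindex F); apply: recursive_subst1. Qed.

Lemma computable_id (X : countType) : computable (@id X).
Proof. exact: (recursive_entry (k := 0)). Qed.
Arguments computable_id {X}.

Lemma drop_tnth T (s : seq T) (i : 'I_(size s)) :
  drop i s = tnth (in_tuple s) i :: drop i.+1 s.
Proof. by rewrite (drop_nth (tnth_default (in_tuple s) i)). Qed.

Lemma computable_foldr (X T U : countType) (g : X -> T -> U -> U) z s :
    computable (fun q : X * T * U => g q.1.1 q.1.2 q.2) ->
    computable z -> computable s ->
  computable (fun x => foldr (g x) (z x) (s x)).
Proof.
move=> comp_g comp_z comp_s.
pose R x i := foldr (g x) (z x) (drop (size (s x) - i) (s x)).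
apply: (eq_recursive (F := fun x => R x (size (s x)))) => [x|].
  by rewrite /R subnn drop0.
apply: (recursive_rec_lt (R := R)); last exact: recursive_size.
  by apply: eq_recursive comp_z => x; rewrite /R subn0 drop_size.
(* [T] may be empty: an item to be read only exists below the recursion bound. *)
pose item (q : {q : X * nat | q.2 < size (s q.1)}) :=
  tnth (in_tuple (s (sval q).1)) (rev_ord (Ordinal (svalP q))).
have drop_item q (x := (sval q).1) (i := (sval q).2) :
    drop (size (s x) - i.+1) (s x) = item q :: drop (size (s x) - i) (s x).
  by rewrite (drop_tnth (rev_ord (Ordinal (svalP q)))) /= subnSK //; apply: svalP q.
pose args q := ((sval q).1, item q, R (sval q).1 (sval q).2).
apply: (eq_recursive (F := fun q => g (args q).1.1 (args q).1.2 (args q).2)) => [q|].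
  by rewrite /R drop_item.
apply: (recursive_comp (F := args) comp_g).
apply: recursive_pair; last exact: (recursive_entry (k := 1)).
apply: recursive_pair; first exact: (recursive_entry (k := 2)).
apply: (recursive_ohead (t := item) (s := fun q =>
    drop (size (s (sval q).1) - (sval q).2.+1) (s (sval q).1))) => [q|].
  by rewrite drop_item.
have rec_s a b := recursive_lift2 (fun q => (sval q).1) a b comp_s.
apply: recursive_drop; last exact: rec_s.
apply: recursive_sub; first by apply: recursive_size; apply: rec_s.
by apply: recursive_succ; apply: (recursive_entry (k := 0)).
Qed.

Lemma computable_map (X T U : countType) (f : X -> T -> U) s :
    computable (fun q : X * T => f q.1 q.2) -> computable s ->
  computable (fun x => map (f x) (s x)).
Proof.
move=> comp_f comp_s.
apply: (eq_recursive (F := fun x => foldr (fun t r => f x t :: r) [::] (s x))) => [x|].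
  by elim: (s x) => //= t r ->.
apply: computable_foldr => //; last exact: recursive_const.
apply: recursive_cons; last exact: recursive_snd computable_id.
exact: (recursive_comp comp_f (recursive_fst computable_id)).
Qed.

Lemma computable_all (X T : countType) (a : X -> pred T) s :
    computable (fun q : X * T => a q.1 q.2) -> computable s ->
  computable (fun x => all (a x) (s x)).
Proof.
move=> comp_a comp_s.
apply: (eq_recursive (F := fun x => foldr (fun t b => a x t && b) true (s x))) => [x|].
  by elim: (s x) => //= t r ->.
apply: computable_foldr => //; last exact: recursive_const.
apply: recursive_andb; last exact: recursive_snd computable_id.
exact: (recursive_comp comp_a (recursive_fst computable_id)).
Qed.

Lemma computable_rcons (X T : countType) (s : X -> seq T) (t : X -> T) :
  computable s -> computable t -> computable (fun x => rcons (s x) (t x)).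
Proof.
move=> comp_s comp_t.
apply: (eq_recursive (F := fun x => foldr cons [:: t x] (s x))) => [x|].
  by elim: (s x) => //= u r ->.
apply: computable_foldr => //; last first.
  by apply: recursive_cons => //; apply: recursive_const.
apply: recursive_cons; last exact: recursive_snd computable_id.
exact: recursive_snd (recursive_fst computable_id).
Qed.

(** * Finite types *)

Lemma recursive_finite_case P n (env : P -> n.-tuple nat) (T : finType) (Y : countType)
    (F : T -> P -> Y) (t : P -> T) :
    (forall i, recursive_from env (F i)) -> recursive_from env t ->
  recursive_from env (fun p => F (t p) p).
Proof.
move=> recF rec_t.
pose lookup r p := foldr (fun i k => if t p == i then pickle (F i p) else k) 0 r.
apply: (recursive_pickle (F := lookup (enum T))) => [p|].
  have: t p \in enum T by rewrite mem_enum.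
  rewrite /lookup; elim: (enum T) => //= i r IHr; rewrite inE.
  by case: eqVneq => [->|_ /IHr].
elim: (enum T) => [|i r IHr] /=; first exact: recursive_const.
apply: recursive_if => //; last exact: recF.
exact: recursive_eq rec_t (recursive_const _ _).
Qed.

Lemma computable_fin (T : finType) (Y : countType) (f : T -> Y) : computable f.
Proof.
apply: (recursive_finite_case (F := fun i _ => f i)); last exact: computable_id.
by move=> i; apply: recursive_const.
Qed.

Lemma computable_map_fin (T : finType) (U : countType) (f : T -> U) : computable (map f).
Proof.
apply: (computable_map (f := fun _ => f)); last exact: computable_id.
exact: recursive_comp (computable_fin f) (recursive_snd computable_id).
Qed.

Lemma pickle_ffun (T : finType) (Y : countType) (f : {ffun T -> Y}) :
  pickle f = pickle [seq (i, f i) | i <- enum T].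
Proof.
have -> : pickle f = code (map pickle (codom (total_fun f))) by [].
by rewrite pickle_seq -!map_comp.
Qed.

Lemma recursive_ffun P n (env : P -> n.-tuple nat) (T : finType) (Y : countType)
    (F : T -> P -> Y) :
    (forall i, recursive_from env (F i)) ->
  recursive_from env (fun p => [ffun i => F i p]).
Proof.
move=> recF; apply: (recursive_pickle (F := fun p =>
    [seq (i, F i p) | i <- enum T])) => [p|].
  by rewrite pickle_ffun; congr pickle; apply: eq_map => i; rewrite ffunE.
elim: (enum T) => [|i r IHr] /=; first exact: recursive_const.
by apply: recursive_cons => //; apply: recursive_pair => //; apply: recursive_const.
Qed.

Lemma recursive_ffun_app P n (env : P -> n.-tuple nat) (T : finType) (Y : countType)
    (f : P -> {ffun T -> Y}) i :
  recursive_from env f -> recursive_from env (fun p => f p i).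
Proof.
move=> rec_f; pose graph p := [seq (j, f p j) | j <- enum T].
have rec_graph : recursive_from env graph.
  by apply: recursive_pickle rec_f => p; rewrite pickle_ffun.
apply: (eq_recursive (F := fun p => (i, f p i).2)) => //; apply: recursive_snd.
apply: (recursive_ohead (s := fun p => drop (index i (enum T)) (graph p))) => [p|].
  rewrite -map_drop (drop_nth i) ?index_mem ?mem_enum //=.
  by rewrite nth_index // mem_enum.
by apply: recursive_drop => //; apply: recursive_const.
Qed.

(** * Words and recursively enumerable languages *)

Lemma word_codeE (S : finType) (w : seq S) : word_code w = pickle (map enum_rank w).
Proof. by rewrite pickle_seq -map_comp. Qed.

Lemma recursive_word_code P n (env : P -> n.-tuple nat) (S : finType) (w : P -> seq S) :
  recursive_from env (fun p => word_code (w p)) <-> recursive_from env w.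
Proof.
split=> rec_w.
  have rec_ranks : recursive_from env (fun p => map enum_rank (w p)).
    by apply: recursive_pickle rec_w => p; rewrite word_codeE.
  apply: (eq_recursive (F := fun p => map enum_val (map enum_rank (w p)))) => [p|].
    exact: mapK enum_rankK (w p).
  exact: recursive_comp (computable_map_fin _) rec_ranks.
apply: (recursive_pickle (F := fun p => map enum_rank (w p))) => [p|].
  by rewrite -word_codeE.
exact: recursive_comp (computable_map_fin _) rec_w.
Qed.

Lemma computable_word_rel (S : finType) (R : rel (seq S)) (Q : seq S -> seq S -> Prop) :
    (forall u v, reflect (Q u v) (R u v)) -> recursive_word_rel Q ->
  computable (fun q : seq S * seq S => R q.1 q.2).
Proof.
move=> RP [f fP].
apply: (recursive_subst2 (a := fun q => word_code q.1) (b := fun q => word_code q.2)).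
- by exists f => -[u v] /=; have [f1 f0] := fP u v; case: (RP u v) => [/f1|/f0].
- by apply/recursive_word_code; apply: recursive_fst computable_id.
- by apply/recursive_word_code; apply: recursive_snd computable_id.
Qed.

Lemma eq_RE (S : finType) (L L' : language S) :
  (forall w, L w <-> L' w) -> RE L -> RE L'.
Proof. by move=> eqL [f fP]; exists f => w; rewrite -eqL. Qed.

Lemma RE_exists_nat (S : finType) (C : seq S -> pred nat) :
  computable (fun q : seq S * nat => C q.1 q.2) -> RE (fun w => exists k, C w k).
Proof.
move=> comp_C.
have [f fP] : recursive_from
    (fun q : seq S * nat => [tuple of q.2 :: [tuple word_code q.1]])
    (fun q => ~~ C q.1 q.2).
  apply: recursive_negb; apply: (recursive_comp (F := id) comp_C).
  apply: (eq_recursive (F := fun q => (q.1, q.2))) => [[]//|].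
  apply: recursive_pair; last exact: (recursive_entry (k := 0)).
  by apply/recursive_word_code; apply: (recursive_entry (k := 1)).
have search w := reval_RMin (v := [tuple word_code w]) (B := C w) (fun k => fP (w, k)).
exists (RMin f) => w; split=> [ex_k|[k /search [Ck _]]]; last by exists k.
case: (ex_minnP ex_k) => k Ck min_k; exists k; apply/search; split=> // i lt_ik.
by apply: contraL lt_ik => /min_k; rewrite -leqNgt.
Qed.

Lemma RE_exists_word (S T : finType) (t0 : T) (C : seq S -> pred (seq T)) :
  computable (fun q : seq S * seq T => C q.1 q.2) -> RE (fun w => exists u, C w u).
Proof.
move=> comp_C; pose word_of_nat k := map (nth t0 (enum T)) (decode k).
have word_of_natP u : exists k, word_of_nat k = u.
  exists (code (map (index^~ (enum T)) u)); rewrite /word_of_nat codeK -map_comp.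
  by apply: map_id_in => t _ /=; rewrite nth_index ?mem_enum.
apply: (eq_RE (L := fun w => exists k, C w (word_of_nat k))) => [w|].
  split=> [[k Ck]|[u Cu]]; first by exists (word_of_nat k).
  by have [k eq_u] := word_of_natP u; exists k; rewrite eq_u.
apply: RE_exists_nat.
apply: (recursive_comp (F := fun q => (q.1, word_of_nat q.2)) comp_C).
apply: recursive_pair; first exact: recursive_fst computable_id.
apply: computable_map.
  exact: recursive_nth (recursive_const _ _) (recursive_snd computable_id).
apply: (recursive_pickle _ (recursive_snd computable_id)) => -[w k].
by rewrite pickle_seq map_id decodeK.
Qed.

(** * Heads on the input tape *)

Section TapeSymbol.
Variable S : finType.

Definition tape_symbol_to_option (x : tape_symbol S) : option (option S) :=
  match x with Letter a => Some (Some a) | LeftEnd => Some None | RightEnd => None end.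

Definition tape_symbol_of_option (x : option (option S)) : tape_symbol S :=
  match x with Some (Some a) => Letter a | Some None => LeftEnd | None => RightEnd end.

Lemma tape_symbol_to_optionK : cancel tape_symbol_to_option tape_symbol_of_option.
Proof. by case. Qed.

HB.instance Definition _ := Finite.copy (tape_symbol S) (can_type tape_symbol_to_optionK).

Lemma read_nth (w : seq S) p : read w p = nth RightEnd (LeftEnd :: map (@Letter S) w) p.
Proof. by case: p => //= p; elim: w p => [|a w IHw] [|p] /=. Qed.

Variables (P : Type) (n : nat) (env : P -> n.-tuple nat) (w : P -> seq S) (F : P -> nat).
Hypotheses (rec_w : recursive_from env w) (rec_F : recursive_from env F).

Lemma recursive_read : recursive_from env (fun p => read (w p) (F p)).
Proof.
apply: (eq_recursive (fun p => esym (read_nth (w p) (F p)))).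
apply: recursive_nth => //; apply: recursive_cons; first exact: recursive_const.
exact: recursive_comp (computable_map_fin _) rec_w.
Qed.

Lemma recursive_move_head d : recursive_from env (fun p => move_head (w p) d (F p)).
Proof.
case: d => /=; [exact: recursive_pred | by [] |].
have rec_last := recursive_succ (recursive_size rec_w).
apply: recursive_if => //; last exact: recursive_succ.
by apply: recursive_leq => //; do 2! apply: recursive_succ.
Qed.

End TapeSymbol.

(** * Replaying a run from the memory symbols that it reads *)

Section Univalent.
Variables (K U T : eqType) (v : U -> K).

Definition univalent (r : seq (U * T)) : bool :=
  all2rel (fun x y => (v x.1 == v y.1) ==> (x.2 == y.2)) r.

Definition interpolates (mu : K -> T) (r : seq (U * T)) : Prop :=
  {in r, forall x, mu (v x.1) = x.2}.

Lemma univalentP (t0 : T) (r : seq (U * T)) :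
  reflect (exists mu, interpolates mu r) (univalent r).
Proof.
apply: (iffP allrelP) => [univ|[mu muP] x y rx ry]; last first.
  by apply/implyP => /eqP eq_v; rewrite -muP // -muP // eq_v.
exists (fun k => head t0 [seq x.2 | x <- r & v x.1 == k]) => x rx.
have: x \in [seq y <- r | v y.1 == v x.1] by rewrite mem_filter eqxx.
case def_s: filter => [//|y s] _ /=.
have: y \in [seq y <- r | v y.1 == v x.1] by rewrite def_s mem_head.
by rewrite mem_filter => /andP [eq_v ry]; apply/eqP/(implyP (univ y x ry rx)).
Qed.

End Univalent.

Lemma computable_univalent (X U T : countType) (K : eqType) (v : U -> K)
    (r : X -> seq (U * T)) :
    computable (fun q : U * U => v q.1 == v q.2) -> computable r ->
  computable (fun x => univalent v (r x)).
Proof.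
move=> comp_v comp_r.
apply: computable_all => //=; apply: computable_all; last first.
  exact: (recursive_comp comp_r (recursive_fst computable_id)).
set Y := (X * (U * T) * (U * T))%type.
have comp_y : computable (fun q : Y => q.1.2).
  exact: recursive_snd (recursive_fst computable_id).
have comp_z : computable (fun q : Y => q.2) by exact: recursive_snd computable_id.
apply: (eq_recursive (F := fun q : Y =>
    ~~ (v q.1.2.1 == v q.2.1) || (q.1.2.2 == q.2.2))) => [q|]; first by rewrite implybE.
apply: recursive_orb; last first.
  exact: recursive_eq (recursive_snd comp_y) (recursive_snd comp_z).
apply: recursive_negb.
apply: (recursive_comp (F := fun q : Y => (q.1.2.1, q.2.1)) comp_v).
exact: recursive_pair (recursive_fst comp_y) (recursive_fst comp_z).
Qed.

Section Replay.
Variables (M : monoidType) (G : {fset M}) (S : finType) (h : nat).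
Variable A : automaton (monoid_memory G) S h.

(* A configuration whose memory cell is given by a word over the generators. *)
Definition word_config : Type := (state A * {ffun 'I_h -> nat} * seq G)%type.

Definition perform (w : seq S) (a : state A * {ffun 'I_h -> head_move} * option G)
    (c : word_config) : word_config :=
  let: (q, d, g) := a in
  (q, [ffun i => move_head w (d i) (c.1.2 i)],
   if g is Some x then rcons c.2 x else c.2).

Definition word_step (w : seq S) (m : msym A) (c : word_config) : word_config :=
  perform w (trans c.1.1 [ffun i => read w (c.1.2 i)] m) c.

(* The symbols [ms] read by the run are listed from the last to the first. *)
Definition replay (w : seq S) (ms : seq (msym A)) :
    word_config * seq (seq G * msym A) :=
  foldr (fun m r => (word_step w m r.1, (r.1.2, m) :: r.2))
    ((start A, [ffun=> 1], [::]), [::]) ms.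

Definition certificate (w : seq S) (ms : seq (msym A)) : bool :=
  ((replay w ms).1.1.1 \in accepting A) &&
  univalent (@word_value M G) (replay w ms).2.

Definition config_of_word (c : word_config) : config A :=
  Config c.1.1 c.1.2 (word_value c.2 : cell (monoid_memory G)).

Lemma step_config_of_word w (mu : cell (monoid_memory G) -> msym A) c :
  step w mu (config_of_word c) = config_of_word (word_step w (mu (word_value c.2)) c).
Proof.
rewrite /step /word_step /perform /=; case: trans => [[q d] [g|]] //=.
by rewrite /config_of_word /= /word_value big_rcons.
Qed.

Lemma iter_step_replay w (mu : cell (monoid_memory G) -> msym A) ms :
    interpolates (@word_value M G) mu (replay w ms).2 ->
  iter (size ms) (step w mu) (init_config A) = config_of_word (replay w ms).1.
Proof.
elim: ms => [_|m ms IHms mu_log] /=.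
  by rewrite /init_config /config_of_word /word_value big_nil.
rewrite IHms => [|x log_x]; last by apply: mu_log; rewrite inE log_x orbT.
by rewrite step_config_of_word (mu_log _ (mem_head _ _)).
Qed.

Lemma exists_interpolated_replay w (mu : cell (monoid_memory G) -> msym A) t :
  exists2 ms, size ms = t & interpolates (@word_value M G) mu (replay w ms).2.
Proof.
elim: t => [|t [ms <- mu_log]]; first by exists [::].
exists (mu (word_value (replay w ms).1.2) :: ms) => // x /=.
by rewrite inE => /predU1P [-> //|/mu_log].
Qed.

Lemma accepts_certificate (m0 : msym A) w :
  accepts A w <-> exists ms, certificate w ms.
Proof.
split=> [[mu [t]]|[ms /andP [acc /(univalentP _ m0) [mu mu_log]]]].
  have [ms <- mu_log] := exists_interpolated_replay w mu t.
  rewrite iter_step_replay // => acc; exists ms; apply/andP; split=> //.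
  by apply/(univalentP _ m0); exists mu.
by exists mu, (size ms); rewrite iter_step_replay.
Qed.

Section Computability.
Variables (X : countType) (w : X -> seq S) (c : X -> word_config).
Hypotheses (comp_w : computable w) (comp_c : computable c).

Let computable_head i : computable (fun x => (c x).1.2 i).
Proof. exact: recursive_ffun_app (recursive_snd (recursive_fst comp_c)). Qed.

Lemma computable_perform a : computable (fun x => perform (w x) a (c x)).
Proof.
case: a => [[q d] g]; apply: recursive_pair.
  apply: recursive_pair; first exact: recursive_const.
  by apply: recursive_ffun => i; apply: recursive_move_head; last exact: computable_head.
case: g => [b|]; last exact: recursive_snd.
exact: computable_rcons (recursive_snd comp_c) (recursive_const _ b).
Qed.

Lemma computable_word_step (m : X -> msym A) :
  computable m -> computable (fun x => word_step (w x) (m x) (c x)).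
Proof.
move=> comp_m; pose input x := ((c x).1.1, [ffun i => read (w x) ((c x).1.2 i)], m x).
pose output y x := perform (w x) (trans y.1.1 y.1.2 y.2) (c x).
apply: (recursive_finite_case (F := output) (t := input)) => [y|].
  exact: computable_perform.
apply: recursive_pair => //; apply: recursive_pair.
  exact: recursive_fst (recursive_fst comp_c).
by apply: recursive_ffun => i; apply: recursive_read; last exact: computable_head.
Qed.

End Computability.

Lemma computable_replay : computable (fun q : seq S * seq (msym A) => replay q.1 q.2).
Proof.
apply: computable_foldr; [|exact: recursive_const|exact: recursive_snd computable_id].
set X := (seq S * seq (msym A))%type.
set R := (word_config * seq (seq G * msym A))%type.
have comp_w : computable (fun q : X * msym A * R => q.1.1.1).
  exact: recursive_fst (recursive_fst (recursive_fst computable_id)).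
have comp_m : computable (fun q : X * msym A * R => q.1.2).
  exact: recursive_snd (recursive_fst computable_id).
have comp_r : computable (fun q : X * msym A * R => q.2).
  exact: recursive_snd computable_id.
have comp_c := recursive_fst comp_r.
apply: recursive_pair; first exact: computable_word_step.
apply: recursive_cons; last exact: recursive_snd.
by apply: recursive_pair => //; apply: recursive_snd.
Qed.

Lemma computable_certificate : decidable_word_problem G ->
  computable (fun q : seq S * seq (msym A) => certificate q.1 q.2).
Proof.
move=> decG; apply: recursive_andb.
  apply: (recursive_comp (computable_fin (fun q => q \in accepting A))).
  exact: recursive_fst (recursive_fst (recursive_fst computable_replay)).
apply: computable_univalent (recursive_snd computable_replay).
pose eq_value (u v : seq G) := word_value u == word_value v.
by apply: (computable_word_rel (R := eq_value) _ decG) => u v; apply: eqP.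
Qed.

End Replay.

Theorem theorem7 (M : monoidType) (G : {fset M}) :
  generates G ->
  decidable_word_problem G ->
  forall (S : finType) (L : language S),
    recognizable (monoid_memory G) L -> RE L.
Proof.
move=> _ decG S L [h [A [_ LA]]].
case: (pickP (@predT (msym A))) => [m0 _|no_symbol].
  apply: eq_RE _ (RE_exists_word m0 (computable_certificate A decG)) => w.
  by rewrite LA accepts_certificate.
apply: eq_RE _ (RE_exists_nat (C := fun _ => pred0) (recursive_const _ false)) => w.
by rewrite LA; split=> [[]//|[mu _]]; have := no_symbol (mu 1%g).
Qed.
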